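(* Let $k\ge 3$ be an integer. Let $(k_r(\lambda))_{r\ge 0}$ be the sequence of polynomials in $\lambda$ defined by $k_0(\lambda)=1$ and, for $r\ge 1$, $$k_{r}(\lambda) = \left(\binom{k-2}{k-3}-\lambda\right)k_{r-1}(\lambda) - \sum_{i=2}^{r}(-1)^{i}\binom{k+i-3}{k-3}k_{r-i}(\lambda).$$ Then for all $r\ge 0$, $$k_{r}(\lambda) = \sum_{\ell=0}^{r}(-1)^\ell\binom{(k-2)(\ell+1)}{r-\ell} \lambda^{\ell}.$$
   Context: Empty sums are $0$; $\binom{a}{b}=0$ for integers $0\le a<b$. *)

(* Defs.v *)
From mathcomp Require Export all_boot all_order all_algebra.

Set Implicit Arguments.
Unset Strict Implicit.
Unset Printing Implicit Defensive.

(* Main.v *)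
(** With [n = k - 2] and [G = \sum_r k_r t^r], the recurrence says
    [G (1 + t)^-n = 1 - X t G], whence
    [G = (1 + t)^n / (1 + X t (1 + t)^n) = \sum_l (-1)^l X^l t^l (1 + t)^(n (l + 1))].
    At the level of coefficients it is enough to know that multiplying
    [(1 + t)^(m + n)] by [(1 + t)^-n] gives [(1 + t)^m]. *)
Require Import Defs.
From mathcomp Require Import all_boot all_order all_algebra.

Set Implicit Arguments.
Unset Strict Implicit.
Unset Printing Implicit Defensive.

Import GRing.Theory.
Local Open Scope ring_scope.

(* For [n = 0] the truncated predecessor makes ['C((0 + i).-1, i)] vanish
   exactly when [0 < i], in accordance with [(1 + t)^0 = 1]. *)
Lemma sum_negbin_bin (A : comNzRingType) (n m s : nat) :
  \sum_(0 <= i < s.+1) (-1) ^+ i * 'C((n + i).-1, i)%:R * 'C(m + n, s - i)%:R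
  = 'C(m, s)%:R :> A.
Proof.
elim: n m s => [|n IHn] m s.
  rewrite big_nat_recl // big1 => [|i _].
    by rewrite addr0 !mul1r addn0 subn0.
  by rewrite add0n /= bin_small // mulr0 mul0r.
elim: s => [|s IHs]; first by rewrite big_nat1 !bin0 !mul1r.
(* Coefficient form of [(1 + t)^-(n+1) = (1 + t)^-n - t (1 + t)^-(n+1)], multiplied by
   [(1 + t)^(m+n+1)]: [IHn] at [m.+1] gives the first binomial, [IHs] the second. *)
transitivity ('C(m.+1, s.+1)%:R - 'C(m, s)%:R : A); last first.
  by rewrite binS natrD addrK.
rewrite -(IHn m.+1) -IHs big_nat_recl // [in RHS]big_nat_recl // -addrA.
rewrite -sumrB !addn0 !bin0 addSnnS; congr (_ + _).
apply: eq_bigr => i _.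
rewrite subSS addSn addnS /= binS natrD exprS mulN1r !mulNr -opprD.
by rewrite mulrDr mulrDl.
Qed.

Lemma exchange_triangle (A : nmodType) (r : nat) (F : nat -> nat -> A) :
  \sum_(0 <= i < r.+1) \sum_(0 <= l < (r - i).+1) F i l
  = \sum_(0 <= l < r.+1) \sum_(0 <= i < (r - l).+1) F i l.
Proof.
(* With the inner bound turned into a condition, the range is rectangular, and [i + l <= r] is
   symmetric in [i] and [l]. *)
have widen (G : nat -> A) j :
    \sum_(0 <= i < (r - j).+1) G i = \sum_(0 <= i < r.+1 | (i < (r - j).+1)%N) G i.
  by rewrite (big_nat_widen _ _ r.+1) // ltnS leq_subr.
under eq_bigr do rewrite widen.
under [RHS]eq_bigr do rewrite widen.
rewrite (exchange_big_dep_nat xpredT) //=.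
apply: eq_big_nat => l /andP[_ lt_l]; rewrite big_nat_cond [RHS]big_nat_cond.
apply: eq_bigl => i; case: (ltnP i r.+1) => //= lt_i.
by rewrite !ltnS in lt_l lt_i *; rewrite !leq_subRL // addnC.
Qed.

Definition closed_form (R : comNzRingType) (n r : nat) : {poly R} :=
  \sum_(0 <= l < r.+1) (-1) ^+ l * 'C(n * (l + 1), r - l)%:R * 'X^l.

(** This is the coefficient of [t^(r+1)] in [G (1 + t)^-n = 1 - X t G]. *)
Lemma closed_form_rec (R : comNzRingType) (n r : nat) :
  \sum_(0 <= i < r.+2)
     (-1) ^+ i * 'C((n + i).-1, i)%:R * closed_form R n (r.+1 - i)
  = - 'X * closed_form R n r.
Proof.
under eq_bigr do rewrite mulr_sumr.
rewrite exchange_triangle.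
(* For fixed [l], the factor [(1 + t)^-n] lowers [(1 + t)^(n (l + 1))] to [(1 + t)^(n l)]. *)
transitivity (\sum_(0 <= l < r.+2) (-1) ^+ l * 'C(n * l, r.+1 - l)%:R * 'X^l : {poly R}).
  apply: eq_big_nat => l _.
  rewrite -(sum_negbin_bin _ n) mulr_sumr mulr_suml; apply: eq_big_nat => i _.
  by rewrite mulnDr muln1 subnAC [in RHS]mulrCA !mulrA.
(* The term [l = 0] vanishes, as ['C(0, r.+1) = 0]; shifting [l] in the others brings out [- 'X]. *)
rewrite big_nat_recl // muln0 bin0n mulr0 mul0r add0r mulr_sumr.
apply: eq_bigr => l _.
by rewrite subSS addn1 !exprS mulN1r !mulNr [in RHS]mulrCA.
Qed.

Theorem theorem7 (R : comNzRingType) (k : nat) (hk : (3 <= k)%N)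
    (kk : nat -> {poly R})
    (kk0 : kk 0%N = 1)
    (kkS : forall r : nat, (1 <= r)%N ->
      kk r = ('C((k - 2)%N, (k - 3)%N)%:R - 'X) * kk (r - 1)%N
             - \sum_(2 <= i < r.+1)
                 (-1) ^+ i * 'C((k + i - 3)%N, (k - 3)%N)%:R * kk (r - i)%N) :
  forall r : nat,
    kk r = \sum_(0 <= l < r.+1)
             (-1) ^+ l * 'C(((k - 2) * (l + 1))%N, (r - l)%N)%:R * 'X^l.
Proof.
case: k hk kkS => [|[|[|k]]] // _ kkS r.
rewrite -[RHS]/(closed_form R (k.+3 - 2) r).
have -> : (k.+3 - 2 = k.+1)%N by rewrite !subSS subn0.
elim/ltn_ind: r => -[_|r IHr].
  by rewrite kk0 /closed_form big_nat1 bin0 !mul1r.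
have binE i : 'C(k.+3 + i - 3, k.+3 - 3) = 'C((k.+1 + i).-1, i).
  by rewrite !addSn !subSS !subn0 /= -bin_sub ?leq_addr // addKn.
(* Solved for its term [i = 0], this is the given recurrence: the term [i = 1] supplies the constant
   next to [- 'X]. *)
have := closed_form_rec R k.+1 r.
rewrite big_nat_recl // subn0 bin0 !mul1r => /(canRL (addrK _)) ->.
rewrite kkS // subn1 /= IHr // mulrBl -mulNr [_ * _ + - _ * _]addrC -addrA.
congr (_ + _); rewrite [in RHS]big_nat_recl // opprD; congr (_ + _).
  rewrite subn1 /= expr1 !mulN1r !mulNr opprK.
  by rewrite -(binE 1%N) addn1 !subSS !subn0.
congr (- _); rewrite big_add1 /= big_add1 /=; apply: eq_big_nat => i /andP[_ lt_i].
by rewrite binE IHr // ltnS !subSS leq_subr.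
Qed.
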